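(* Let $n\ge4$. (1) Let $\mathbf z=(z_\alpha)_{\alpha\in I_n}$ be a Heronian frieze of order $n$ such that $z_{(i,j)}\ne0$ for every $(i,j)\in\mathbb Z^2$ with $2\le j-i\le n-2$. Then the restriction of $\mathbf z$ to $I_n^{\mathrm{CM}}$ is a coherent Cayley-Menger frieze. (2) Conversely, let $\mathbf z_{\mathrm{CM}}=(z_\alpha)_{\alpha\in I_n^{\mathrm{CM}}}$ be a coherent Cayley-Menger frieze of order $n$ such that $z_{(i,j)}\ne0$ for every $(i,j)\in\mathbb Z^2$ with $2\le j-i\le n-2$, and such that for every $(i,j)\in\mathbb Z^2$ with $2\le j-i\le n-1$, $$H(z_{(i,j)},z_{(i+1,j)},z_{(i+\frac12,/)})\ne0,\qquad H(z_{(i,j-1)},z_{(i,j)},z_{(\backslash,j-\frac12)})\ne0 .$$ Then there exists a Heronian frieze $\mathbf z=(z_\alpha)_{\alpha\in I_n}$ which extends $\mathbf z_{\mathrm{CM}}$. This extension is unique up to a global (simultaneous) change of sign of all the entries indexed by $I_n\setminus I_n^{\mathrm{CM}}$.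
   Context: $H(p,q,r)=-p^2-q^2-r^2+2pq+2pr+2qr$. A Heronian diamond is an ordered 10-tuple $(a,b,c,d,e,f,p,q,r,s)$ of complex numbers satisfying $p^2=H(b,c,e)$, $q^2=H(a,d,e)$, $r^2=H(a,f,b)$, $s^2=H(c,f,d)$, $r+s=p+q$, $4ef=(p+q)^2+(a-b+c-d)^2$, and $e(r-s)=p(a-d)+q(b-c)$. Index sets, for $n\ge4$: $N_n=\{(i,j)\in(\mathbb Z\times\frac12\mathbb Z)\cup(\frac12\mathbb Z\times\mathbb Z): 0\le j-i\le n\}$; $L_n=\{(i+\frac12,/): i\in\mathbb Z\}\cup\{(\backslash,j+\frac12): j\in\mathbb Z\}$ (formal indices); $I_n=N_n\sqcup L_n$; $I_n^{\mathrm{CM}}=\{(i,j)\in\mathbb Z^2:0\le j-i\le n\}\sqcup L_n\subset I_n$. A Heronian frieze of order $n$ is an array $\mathbf z=(z_\alpha)_{\alpha\in I_n}$ of complex numbers such that (1) for every $(i,j)\in\mathbb Z^2$ with $1\le j-i\le n-1$ the 10-tuple $$(z_{(i,j+1)}, z_{(i+\frac12,/)}, z_{(i+1,j)}, z_{(\backslash,j+\frac12)}, z_{(i,j)}, z_{(i+1,j+1)}, z_{(i+\frac12,j)}, z_{(i,j+\frac12)}, z_{(i+\frac12,j+1)}, z_{(i+1,j+\frac12)})$$ is a Heronian diamond (in the order $(a,b,c,d,e,f,p,q,r,s)$); and (2) $z_{(i,j)}=0$ for every $(i,j)\in N_n$ with $j-i\in\{0,\frac12,n-\frac12,n\}$.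 The Cayley-Menger polynomial is $$M(a,b,c,d,e,f)=\det\begin{bmatrix}0&1&1&1&1\\1&0&b&e&a\\1&b&0&c&f\\1&e&c&0&d\\1&a&f&d&0\end{bmatrix}.$$ A Cayley-Menger diamond is a 6-tuple $(a,b,c,d,e,f)\in\mathbb C^6$ with $M(a,b,c,d,e,f)=0$. Notation: $\partial_\uparrow M=\partial M/\partial a$, $\partial_\downarrow M=\partial M/\partial c$, $\partial_\leftarrow M=\partial M/\partial e$, $\partial_\rightarrow M=\partial M/\partial f$. For an array $\mathbf z=(z_\alpha)_{\alpha\in I_n^{\mathrm{CM}}}$ of complex numbers and $(i,j)\in\mathbb Z^2$ with $1\le j-i\le n-1$ put $$\Diamond_{i,j}(\mathbf z)=(z_{(i,j+1)},z_{(i+\frac12,/)},z_{(i+1,j)},z_{(\backslash,j+\frac12)},z_{(i,j)},z_{(i+1,j+1)}).$$ A Cayley-Menger frieze of order $n$ is such an array in which every $\Diamond_{i,j}(\mathbf z)$, $1\le j-i\le n-1$, is a Cayley-Menger diamond and, for all $i\in\mathbb Z$: $z_{(i,i)}=0$, $z_{(i,i+1)}=z_{(i+\frac12,/)}=z_{(\backslash,i+\frac12)}$, $z_{(i,i+n)}=0$, $z_{(i,i+n-1)}=z_{(i-\frac12,/)}=z_{(\backslash,i+n-\frac12)}$. It is coherent if for all $(i,j)\in\mathbb Z^2$ with $2\le j-i\le n-2$ $$\partial_\leftarrow M(\Diamond_{i-1,j-1}(\mathbf z))\,\partial_\rightarrow M(\Diamond_{i,j}(\mathbf z))=\partial_\uparrow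 M(\Diamond_{i-1,j}(\mathbf z))\,\partial_\downarrow M(\Diamond_{i,j-1}(\mathbf z)).$$ *)

(* Defs.v *)
From HB Require Import structures.
From mathcomp Require Import all_boot all_order all_algebra.
From mathcomp Require Export reals complex.
From mathcomp Require Export mpoly.

Set Implicit Arguments.
Unset Strict Implicit.
Unset Printing Implicit Defensive.

Import GRing.Theory.
Local Open Scope ring_scope.

(* The points of (Z x 1/2 Z) U (1/2 Z x Z), with each half-integer coordinate
   written as an integer plus 1/2:
     Pt i j = (i, j),   PtL i j = (i + 1/2, j),   PtR i j = (i, j + 1/2). *)
Inductive node : Type :=
  | Pt of int & int
  | PtL of int & int
  | PtR of int & int.

(* Twice the coordinates, which are integers. *)
Definition dbl_fst (v : node) : int :=
  match v with
  | Pt i _ | PtR i _ => 2 * i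
  | PtL i _ => 2 * i + 1
  end.

Definition dbl_snd (v : node) : int :=
  match v with
  | Pt _ j | PtL _ j => 2 * j
  | PtR _ j => 2 * j + 1
  end.

(* 2 (j - i) for the point (i, j) *)
Definition dbl_gap (v : node) : int := dbl_snd v - dbl_fst v.

(* Slash i = (i + 1/2, /) and Bslash j = (\, j + 1/2). *)
Inductive frieze_index : Type :=
  | Node of node
  | Slash of int
  | Bslash of int.

Coercion Node : node >-> frieze_index.

Definition N_ (n : nat) : {pred node} :=
  [pred v | 0 <= dbl_gap v <= 2 * n%:Z].

Definition I_ (n : nat) : {pred frieze_index} :=
  fun x => match x with
           | Node v => v \in N_ n
           | Slash _ | Bslash _ => true
           end.

Definition ICM_ (n : nat) : {pred frieze_index} :=
  fun x => match x with
           | Node (Pt i j) => 0 <= j - i <= n%:Z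
           | Node (PtL _ _) | Node (PtR _ _) => false
           | Slash _ | Bslash _ => true
           end.

Definition heronH (K : comNzRingType) (p q r : K) : K :=
  - p ^+ 2 - q ^+ 2 - r ^+ 2 + 2 * p * q + 2 * p * r + 2 * q * r.

Definition Heronian_diamond (K : comNzRingType) (a b c d e f p q r s : K) : Prop :=
  [/\ [/\ p ^+ 2 = heronH b c e, q ^+ 2 = heronH a d e, r ^+ 2 = heronH a f b
        & s ^+ 2 = heronH c f d],
      r + s = p + q,
      4 * e * f = (p + q) ^+ 2 + (a - b + c - d) ^+ 2
    & e * (r - s) = p * (a - d) + q * (b - c)].

(* An array (z_x) indexed by I_ n or ICM_ n is represented by a total function
   on [frieze_index].  The predicates below only read the entries in the
   relevant index set, so that a restriction of an array is represented by the
   same function, and arrays are compared on their index set only. *)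

Definition Heronian_frieze (K : comNzRingType) (n : nat)
    (z : frieze_index -> K) : Prop :=
  (forall i j : int, 1 <= j - i <= n%:Z - 1 ->
     Heronian_diamond
       (z (Pt i (j + 1))) (z (Slash i)) (z (Pt (i + 1) j)) (z (Bslash j))
       (z (Pt i j)) (z (Pt (i + 1) (j + 1)))
       (z (PtL i j)) (z (PtR i j)) (z (PtL i (j + 1))) (z (PtR (i + 1) j)))
  /\ (forall v : node, v \in N_ n ->
        dbl_gap v \in [:: 0; 1; 2 * n%:Z - 1; 2 * n%:Z] -> z v = 0).

Definition CM_det (K : comNzRingType) (a b c d e f : K) : K :=
  let rows := [:: [:: 0; 1; 1; 1; 1];
                  [:: 1; 0; b; e; a];
                  [:: 1; b; 0; c; f];
                  [:: 1; e; c; 0; d];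
                  [:: 1; a; f; d; 0]] in
  \det (\matrix_(i < 5, j < 5) nth 0 (nth [::] rows i) j).

Definition va : 'I_6 := @Ordinal 6 0 isT.
Definition vb : 'I_6 := @Ordinal 6 1 isT.
Definition vc : 'I_6 := @Ordinal 6 2 isT.
Definition vd : 'I_6 := @Ordinal 6 3 isT.
Definition ve : 'I_6 := @Ordinal 6 4 isT.
Definition vf : 'I_6 := @Ordinal 6 5 isT.

Definition CM_poly (K : comNzRingType) : {mpoly K[6]} :=
  CM_det 'X_va 'X_vb 'X_vc 'X_vd 'X_ve 'X_vf.

Definition CM_diamond (K : comNzRingType) (t : 6.-tuple K) : Prop :=
  (CM_poly K).@[tnth t] = 0.

Definition dM (K : comNzRingType) (v : 'I_6) (t : 6.-tuple K) : K :=
  ((CM_poly K)^`M(v)).@[tnth t].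

Definition dM_up (K : comNzRingType) (t : 6.-tuple K) : K := dM va t.
Definition dM_down (K : comNzRingType) (t : 6.-tuple K) : K := dM vc t.
Definition dM_left (K : comNzRingType) (t : 6.-tuple K) : K := dM ve t.
Definition dM_right (K : comNzRingType) (t : 6.-tuple K) : K := dM vf t.

Definition diamond (K : comNzRingType) (z : frieze_index -> K)
    (i j : int) : 6.-tuple K :=
  [tuple z (Pt i (j + 1)); z (Slash i); z (Pt (i + 1) j); z (Bslash j);
         z (Pt i j); z (Pt (i + 1) (j + 1))].

Definition CM_frieze (K : comNzRingType) (n : nat)
    (z : frieze_index -> K) : Prop :=
  (forall i j : int, 1 <= j - i <= n%:Z - 1 -> CM_diamond (diamond z i j))
  /\ (forall i : int,
        [/\ z (Pt i i) = 0,
            z (Pt i (i + 1)) = z (Slash i) /\ z (Slash i) = z (Bslash i),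
            z (Pt i (i + n%:Z)) = 0
          & z (Pt i (i + n%:Z - 1)) = z (Slash (i - 1))
            /\ z (Slash (i - 1)) = z (Bslash (i + n%:Z - 1))]).

Definition coherent (K : comNzRingType) (n : nat) (z : frieze_index -> K) : Prop :=
  forall i j : int, 2 <= j - i <= n%:Z - 2 ->
    dM_left (diamond z (i - 1) (j - 1)) * dM_right (diamond z i j) =
    dM_up (diamond z (i - 1) j) * dM_down (diamond z i (j - 1)).

Definition coherent_CM_frieze (K : comNzRingType) (n : nat)
    (z : frieze_index -> K) : Prop :=
  CM_frieze n z /\ coherent n z.

Definition eq_on (K : Type) (D : {pred frieze_index}) (z z' : frieze_index -> K) : Prop :=
  forall x, x \in D -> z x = z' x.

Definition flip_sign (K : comNzRingType) (n : nat)
    (z : frieze_index -> K) : frieze_index -> K :=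
  fun x => if x \in ICM_ n then z x else - z x.

(* Main.v *)
Require Import Defs.
From mathcomp Require Import all_boot all_order all_algebra.
From mathcomp Require Import ring zify.
Import GRing.Theory Num.Theory.
Local Open Scope ring_scope.
Local Open Scope complex_scope.

(* In a Heronian diamond each partial derivative of M with respect to an entry
   of the vertical or horizontal axis is, up to the factor 2 or -2, the product
   of two of p, q, r, s: right = -2pq, left = -2rs, up = 2ps, down = 2qr.  Hence
   coherence at a node is the trivial identity between the two ways of
   multiplying the four half-integer entries around it.

   Conversely, the squares of the half-integer entries are prescribed and
   nonzero, and one entry p of a diamond determines q, r and s.  The entries w_i
   at (i + 1/2, i + 2) are fixed up to a global sign by one square root and the
   products w_i w_(i+1); the remaining rows are then computed one after the
   other, coherence being exactly what makes the next row satisfy the product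
   relation for "up" again. *)

(** * The Cayley-Menger determinant and its derivatives as explicit polynomials *)

Fixpoint laplace {K : comNzRingType} m (g : nat -> nat -> K) : K :=
  if m is m'.+1 then
    foldr (fun j x => (if odd j then -1 else 1) * g 0%N j
                       * laplace m' (fun i k => g i.+1 (bump j k)) + x)
          0 (iota 0 m)
  else 1.

(** For a concrete size and concrete entries, [laplace] unfolds by computation to a polynomial
    expression, which [ring] can then handle. *)
Lemma laplaceE {K : comNzRingType} m (g : nat -> nat -> K) :
  \det (\matrix_(i < m, j < m) g i j) = laplace m g.
Proof.
elim: m g => [|m IHm] g; first by rewrite det_mx00.
rewrite (expand_det_row _ ord0).
rewrite [RHS](_ : _ = \sum_(0 <= j < m.+1) (if odd j then -1 else 1) * g 0%N j
    * laplace m (fun i k => g i.+1 (bump j k))); last by rewrite unlock.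
rewrite big_mkord; apply: eq_bigr => j _.
rewrite mxE /cofactor add0n -signr_odd -IHm mulrCA mulrA.
have -> : row' ord0 (col' j (\matrix_(i < m.+1, k < m.+1) g i k)) =
    \matrix_(i < m, k < m) g i.+1 (bump j k).
  by apply/matrixP => i k; rewrite !mxE.
by case: (odd j).
Qed.

Definition CM_expr {K : comNzRingType} (a b c d e f : K) : K :=
  2 * (e * f * (a + b + c + d - e - f) + a * c * (b + d + e + f - a - c)
       + b * d * (a + c + e + f - b - d)
       - b * c * e - a * d * e - a * b * f - c * d * f).

Lemma CM_detE (K : comNzRingType) (a b c d e f : K) :
  CM_det a b c d e f = CM_expr a b c d e f.
Proof.
rewrite -[LHS]/(\det (\matrix_(i < 5, j < 5) (fun i j : nat => nth 0 (nth [::]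
  [:: [:: 0; 1; 1; 1; 1]; [:: 1; 0; b; e; a]; [:: 1; b; 0; c; f];
      [:: 1; e; c; 0; d]; [:: 1; a; f; d; 0]] i) j) i j)).
rewrite laplaceE /CM_expr /= /bump /=.
ring.
Qed.

Lemma CM_diamondE {K : comNzRingType} (a b c d e f : K) :
  CM_diamond [tuple a; b; c; d; e; f] <-> CM_expr a b c d e f = 0.
Proof.
rewrite /CM_diamond /CM_poly CM_detE /CM_expr.
by rewrite !(mevalM, mevalD, mevalN, mevalXU, meval1).
Qed.

Lemma mderiv_var {K : comNzRingType} m (v w : 'I_m) :
  ('X_w : {mpoly K[m]})^`M(v) = (w == v)%:R.
Proof.
rewrite mderivX mnm1E; case: eqP => [->|_]; last by rewrite scale0r.
have -> : (U_(v) - U_(v))%MM = 0%MM :> 'X_{1..m}.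
  by apply/mnmP => i; rewrite mnmBE subnn mnm0E.
by rewrite mpolyX0 scale1r.
Qed.

(** All six derivatives share one computation: for a given [v] exactly one of the indicator
    coefficients is 1. *)
Lemma dME {K : comNzRingType} (v : 'I_6) (a b c d e f : K) :
  dM v [tuple a; b; c; d; e; f] =
  2 * ((va == v)%:R * (c * (b + d + e + f - c - 2 * a) + (e - b) * (f - d))
     + (vb == v)%:R * (d * (a + c + e + f - d - 2 * b) + (a - e) * (c - f))
     + (vc == v)%:R * (a * (b + d + e + f - a - 2 * c) + (e - d) * (f - b))
     + (vd == v)%:R * (b * (a + c + e + f - b - 2 * d) + (a - f) * (c - e))
     + (ve == v)%:R * (f * (a + b + c + d - f - 2 * e) + (a - b) * (c - d))
     + (vf == v)%:R * (e * (a + b + c + d - e - 2 * f) + (a - d) * (c - b))).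
Proof.
rewrite /dM /CM_poly CM_detE /CM_expr.
rewrite !(mderivM, mderivD, mderivN, mderiv_var, mderivC).
rewrite !(mevalM, mevalD, mevalN, mevalXU, meval0, meval1, rmorph_nat).
rewrite !(tnth_nth 0) /=.
ring.
Qed.

Lemma dM_upE {K : comNzRingType} (a b c d e f : K) :
  dM_up [tuple a; b; c; d; e; f] =
  2 * (c * (b + d + e + f - c - 2 * a) + (e - b) * (f - d)).
Proof. by rewrite /dM_up dME /=; ring. Qed.

Lemma dM_downE {K : comNzRingType} (a b c d e f : K) :
  dM_down [tuple a; b; c; d; e; f] =
  2 * (a * (b + d + e + f - a - 2 * c) + (e - d) * (f - b)).
Proof. by rewrite /dM_down dME /=; ring. Qed.

Lemma dM_leftE {K : comNzRingType} (a b c d e f : K) :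
  dM_left [tuple a; b; c; d; e; f] =
  2 * (f * (a + b + c + d - f - 2 * e) + (a - b) * (c - d)).
Proof. by rewrite /dM_left dME /=; ring. Qed.

Lemma dM_rightE {K : comNzRingType} (a b c d e f : K) :
  dM_right [tuple a; b; c; d; e; f] =
  2 * (e * (a + b + c + d - e - 2 * f) + (a - d) * (c - b)).
Proof. by rewrite /dM_right dME /=; ring. Qed.

(** * Heronian diamonds versus Cayley-Menger diamonds *)

Section Diamond.
Context {K : fieldType}.
Hypothesis two_neq0 : 2 != 0 :> K.
Implicit Types a b c d e f p q r s : K.

(** As a polynomial in [a], M is quadratic with leading coefficient [-2c] and discriminant
    [4 H(b,c,e) H(c,f,d)]. The squared derivative of a quadratic is its discriminant plus four times
    the leading coefficient times its value, and the value is 0 here. The same argument in [f] gives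
    [dM_right_sqr]. *)
Lemma dM_up_sqr {a b c d e f} : CM_diamond [tuple a; b; c; d; e; f] ->
  dM_up [tuple a; b; c; d; e; f] ^+ 2 = 4 * heronH b c e * heronH c f d.
Proof.
move=> /CM_diamondE M0; rewrite dM_upE.
transitivity (4 * heronH b c e * heronH c f d - 8 * c * CM_expr a b c d e f).
  by rewrite /CM_expr /heronH; ring.
by rewrite M0; ring.
Qed.

Lemma dM_right_sqr {a b c d e f} : CM_diamond [tuple a; b; c; d; e; f] ->
  dM_right [tuple a; b; c; d; e; f] ^+ 2 = 4 * heronH b c e * heronH a d e.
Proof.
move=> /CM_diamondE M0; rewrite dM_rightE.
transitivity (4 * heronH b c e * heronH a d e - 8 * e * CM_expr a b c d e f).
  by rewrite /CM_expr /heronH; ring.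
by rewrite M0; ring.
Qed.

Section OfHeronian.
Context {a b c d e f p q r s : K}.
Hypothesis Hd : Heronian_diamond a b c d e f p q r s.

(** The product [2pq] is the excess of [(p + q) ^+ 2] over [p ^+ 2 + q ^+ 2], and the diamond
    equations express all three squares by the integer entries. *)
Lemma Heronian_right : dM_right [tuple a; b; c; d; e; f] = - 2 * (p * q).
Proof.
case: Hd => [[p2 q2 _ _] _ ef _]; rewrite dM_rightE.
have -> : - 2 * (p * q) = p ^+ 2 + q ^+ 2 - (p + q) ^+ 2 by ring.
rewrite p2 q2 (_ : (p + q) ^+ 2 = 4 * e * f - (a - b + c - d) ^+ 2).
  by rewrite /heronH; ring.
by rewrite ef; ring.
Qed.

Lemma Heronian_left : dM_left [tuple a; b; c; d; e; f] = - 2 * (r * s).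
Proof.
case: Hd => [[_ _ r2 s2] rs ef _]; rewrite dM_leftE.
have -> : - 2 * (r * s) = r ^+ 2 + s ^+ 2 - (r + s) ^+ 2 by ring.
rewrite r2 s2 rs (_ : (p + q) ^+ 2 = 4 * e * f - (a - b + c - d) ^+ 2).
  by rewrite /heronH; ring.
by rewrite ef; ring.
Qed.

Hypothesis e_neq0 : e != 0.
Let e2_neq0 : 2 * e != 0 := mulf_neq0 two_neq0 e_neq0.

(** Subtracting the two linear relations expresses [2es] by [p] and [q]. After multiplication by [p]
    only [p ^+ 2] and [pq] occur, and both are known. The relation for [r - s] carries the factor
    [e], hence the hypothesis on [e]. *)
Lemma Heronian_up : dM_up [tuple a; b; c; d; e; f] = 2 * (p * s).
Proof.
have pq := Heronian_right; case: Hd => [[p2 q2 _ _] rs _ ers].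
apply: (mulfI e2_neq0); move: pq; rewrite dM_upE dM_rightE => pq.
have -> : 2 * e * (2 * (p * s)) = 2 * p * (e * (r + s) - e * (r - s)) by ring.
rewrite rs ers.
have -> : 2 * p * (e * (p + q) - (p * (a - d) + q * (b - c))) =
  2 * (p ^+ 2 * (e - a + d)) - (- 2 * (p * q)) * (e - b + c) by ring.
by rewrite -pq p2 /heronH; ring.
Qed.

Lemma Heronian_down : dM_down [tuple a; b; c; d; e; f] = 2 * (q * r).
Proof.
have pq := Heronian_right; case: Hd => [[p2 q2 _ _] rs _ ers].
apply: (mulfI e2_neq0); move: pq; rewrite dM_downE dM_rightE => pq.
have -> : 2 * e * (2 * (q * r)) = 2 * q * (e * (r + s) + e * (r - s)) by ring.
rewrite rs ers.
have -> : 2 * q * (e * (p + q) + (p * (a - d) + q * (b - c))) =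
  2 * (q ^+ 2 * (e + b - c)) - (- 2 * (p * q)) * (e + a - d) by ring.
by rewrite -pq q2 /heronH; ring.
Qed.

(** The discriminant identity in [f] makes [8eM] equal to [4 p^2 q^2 - (2pq)^2], which is 0. *)
Lemma Heronian_CM : CM_diamond [tuple a; b; c; d; e; f].
Proof.
apply/CM_diamondE; have := Heronian_right; case: Hd => [[p2 q2 _ _] _ _ _].
rewrite dM_rightE => pq; apply: (mulfI e2_neq0); apply: (mulfI two_neq0); apply: (mulfI two_neq0).
rewrite !mulr0.
transitivity (4 * heronH b c e * heronH a d e - (- 2 * (p * q)) ^+ 2).
  by rewrite -pq /CM_expr /heronH; ring.
by rewrite -p2 -q2; ring.
Qed.
End OfHeronian.

(** The converse: the formula for right forces [q], and the linear relation forces [r]. The value of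
    [s ^+ 2] leaves a sign open; the hypothesis on [dM_up] ties it to that of [p]. *)
Lemma Heronian_of_CM {a b c d e f p s} : CM_diamond [tuple a; b; c; d; e; f] ->
  p != 0 -> e != 0 -> p ^+ 2 = heronH b c e -> s ^+ 2 = heronH c f d ->
  dM_up [tuple a; b; c; d; e; f] = 2 * (p * s) ->
  let q := - dM_right [tuple a; b; c; d; e; f] / (2 * p) in
  Heronian_diamond a b c d e f p q (p + q - s) s.
Proof.
move=> M p_neq0 e_neq0 p2 s2 ps q.
have pq : dM_right [tuple a; b; c; d; e; f] = - 2 * (p * q).
  by rewrite /q; field; apply/andP.
have q2 : q ^+ 2 = heronH a d e.
  have pp : 4 * p ^+ 2 != 0.
    by rewrite (_ : 4 = 2 * 2 :> K); [rewrite !mulf_neq0 ?expf_neq0 | ring].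
  apply: (mulfI pp); rewrite {2}p2 -(dM_right_sqr M) pq; ring.
(* With [r = p + q - s], this is the relation for [e * (r - s)]. *)
have es : 2 * e * s = p * (e - a + d) + q * (e - b + c).
  apply: (mulfI p_neq0); apply: (mulfI two_neq0).
  have -> : 2 * (p * (2 * e * s)) = 2 * e * (2 * (p * s)) by ring.
  have -> : 2 * (p * (p * (e - a + d) + q * (e - b + c))) =
    2 * (p ^+ 2 * (e - a + d)) - (- 2 * (p * q)) * (e - b + c) by ring.
  by rewrite -ps -pq p2 dM_upE dM_rightE /heronH; ring.
split.
- split=> //.
  have ee : 4 * e ^+ 2 != 0.
    by rewrite (_ : 4 = 2 * 2 :> K); [rewrite !mulf_neq0 ?expf_neq0 | ring].
  (* The square of [r] is computed after clearing denominators: [2er] is linear in [p] and [q], so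
     its square involves only [p ^+ 2], [q ^+ 2] and [pq]. *)
  apply: (mulfI ee).
  have -> : 4 * e ^+ 2 * (p + q - s) ^+ 2 = (2 * e * (p + q) - 2 * e * s) ^+ 2.
    by ring.
  rewrite es.
  have -> : (2 * e * (p + q) - (p * (e - a + d) + q * (e - b + c))) ^+ 2 =
    p ^+ 2 * (e + a - d) ^+ 2 + q ^+ 2 * (e + b - c) ^+ 2
      - (- 2 * (p * q)) * (e + a - d) * (e + b - c) by ring.
  rewrite -pq p2 q2 dM_rightE.
  transitivity (4 * e ^+ 2 * heronH a f b - 2 * e * CM_expr a b c d e f).
    by rewrite /CM_expr /heronH; ring.
  by move/CM_diamondE: M => ->; ring.
- by ring.
- have -> : (p + q) ^+ 2 = p ^+ 2 + q ^+ 2 - (- 2 * (p * q)) by ring.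
  by rewrite -pq p2 q2 dM_rightE /heronH; ring.
- have -> : e * (p + q - s - s) = e * (p + q) - 2 * e * s by ring.
  by rewrite es; ring.
Qed.
End Diamond.

(** * Degenerate diamonds along the two boundaries *)

Section BoundaryDiamond.
Context {K : fieldType}.
Implicit Types a b c d e f p q r s : K.

Lemma heronH_0 (x y : K) : heronH x 0 y = - (x - y) ^+ 2.
Proof. by rewrite /heronH; ring. Qed.

Lemma heronH_eq0 {x y : K} : 0 ^+ 2 = heronH x 0 y -> y = x.
Proof.
rewrite heronH_0 expr0n /= => /esym/eqP; rewrite oppr_eq0 expf_eq0 /= subr_eq0.
by move/eqP.
Qed.

(** When one argument of [heronH] is 0, the value is minus the square of the difference of the other
    two. So [p = 0] merges [e] with [b], and [s = 0] merges [f] with [d]. *)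
Lemma Heronian_bottom {a b d e f q r} : Heronian_diamond a b 0 d e f 0 q r 0 ->
  [/\ e = b, f = d, r = q & q ^+ 2 = heronH a d b].
Proof.
case=> [[p2 q2 _ s2]]; rewrite addr0 add0r => -> _ _.
have ee := heronH_eq0 p2; have ff : f = d; last by split; rewrite // q2 ee.
by apply: heronH_eq0; rewrite s2 /heronH; ring.
Qed.

Lemma Heronian_top {b c d e f p s} : Heronian_diamond 0 b c d e f p 0 0 s ->
  [/\ e = d, f = b, s = p & p ^+ 2 = heronH b c d].
Proof.
case=> [[p2 q2 r2 _]]; rewrite addr0 add0r => -> _ _.
have ee : e = d by apply: heronH_eq0; rewrite q2 /heronH; ring.
split=> //; last by rewrite p2 ee.
by apply: heronH_eq0; rewrite r2 /heronH; ring.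
Qed.

Lemma bottom_Heronian {a b d q} : q ^+ 2 = heronH a d b ->
  Heronian_diamond a b 0 d b d 0 q q 0.
Proof.
move=> q2; split; [split=> //; rewrite ?q2 /heronH; ring | ring | | ring].
by rewrite add0r q2 /heronH; ring.
Qed.

Lemma top_Heronian {b c d p} : p ^+ 2 = heronH b c d ->
  Heronian_diamond 0 b c d d b p 0 0 p.
Proof.
move=> p2; split; [split=> //; rewrite ?p2 /heronH; ring | ring | | ring].
by rewrite addr0 p2 /heronH; ring.
Qed.

(** Two of the four points have the same distances to all points, so two rows of the matrix
    coincide; likewise in [CM_top]. *)
Lemma CM_bottom a b d : CM_diamond [tuple a; b; 0; d; b; d].
Proof. by apply/CM_diamondE; rewrite /CM_expr; ring. Qed.

Lemma CM_top b c d : CM_diamond [tuple 0; b; c; d; d; b].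
Proof. by apply/CM_diamondE; rewrite /CM_expr; ring. Qed.

Lemma dM_down_bottom a b d :
  dM_down [tuple a; b; 0; d; b; d] = 2 * heronH a d b.
Proof. by rewrite dM_downE /heronH; ring. Qed.

Lemma dM_up_top b c d : dM_up [tuple 0; b; c; d; d; b] = 2 * heronH b c d.
Proof. by rewrite dM_upE /heronH; ring. Qed.

End BoundaryDiamond.

(** * From a Heronian frieze to a coherent Cayley-Menger frieze *)

Section HeronianFrieze.
Context {K : fieldType}.
Context {n : nat}.
Hypothesis hn : (4 <= n)%N.
Context {z : frieze_index -> K}.
Hypothesis Hz : Heronian_frieze n z.

Lemma frieze_Pt_bottom i j : j = i -> z (Pt i j) = 0.
Proof. by move=> ->; apply: (proj2 Hz); rewrite !inE /dbl_gap /=; lia. Qed.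
Lemma frieze_Pt_top i j : j = i + n%:Z -> z (Pt i j) = 0.
Proof. by move=> ->; apply: (proj2 Hz); rewrite !inE /dbl_gap /=; lia. Qed.
Lemma frieze_PtL_bottom i j : j = i + 1 -> z (PtL i j) = 0.
Proof. by move=> ->; apply: (proj2 Hz); rewrite !inE /dbl_gap /=; lia. Qed.
Lemma frieze_PtL_top i j : j = i + n%:Z -> z (PtL i j) = 0.
Proof. by move=> ->; apply: (proj2 Hz); rewrite !inE /dbl_gap /=; lia. Qed.
Lemma frieze_PtR_bottom i j : j = i -> z (PtR i j) = 0.
Proof. by move=> ->; apply: (proj2 Hz); rewrite !inE /dbl_gap /=; lia. Qed.
Lemma frieze_PtR_top i j : j = i + n%:Z - 1 -> z (PtR i j) = 0.
Proof. by move=> ->; apply: (proj2 Hz); rewrite !inE /dbl_gap /=; lia. Qed.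

Lemma frieze_bottom i j : j = i + 1 ->
  [/\ z (Pt i j) = z (Slash i), z (Pt (i + 1) (j + 1)) = z (Bslash j),
      z (PtL i (j + 1)) = z (PtR i j)
    & z (PtR i j) ^+ 2 = heronH (z (Pt i (j + 1))) (z (Bslash j)) (z (Slash i))].
Proof.
move=> ji; have := (proj1 Hz) i j; rewrite (@frieze_Pt_bottom (i + 1) j) //.
rewrite (@frieze_PtL_bottom i j) // (@frieze_PtR_bottom (i + 1)) // => H.
by apply: Heronian_bottom (H ltac:(lia)).
Qed.

Lemma frieze_top i j : j = i + n%:Z - 1 ->
  [/\ z (Pt i j) = z (Bslash j), z (Pt (i + 1) (j + 1)) = z (Slash i),
      z (PtR (i + 1) j) = z (PtL i j)
    & z (PtL i j) ^+ 2 = heronH (z (Slash i)) (z (Pt (i + 1) j)) (z (Bslash j))].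
Proof.
move=> ji; have := (proj1 Hz) i j; rewrite (@frieze_Pt_top i (j + 1)); last by lia.
rewrite (@frieze_PtR_top i j) // (@frieze_PtL_top i (j + 1)); last by lia.
by move=> H; apply: Heronian_top (H ltac:(lia)).
Qed.

Hypothesis two_neq0 : 2 != 0 :> K.
Hypothesis z_neq0 : forall i j : int, 2 <= j - i <= n%:Z - 2 -> z (Pt i j) <> 0.

Lemma frieze_CM_diamond i j : 1 <= j - i <= n%:Z - 1 -> CM_diamond (diamond z i j).
Proof.
move=> hij; have [j1|j1] := eqVneq j (i + 1).
  rewrite /diamond; have [-> -> _ _] := frieze_bottom _ _ j1.
  by rewrite (@frieze_Pt_bottom (i + 1) j) //; apply: CM_bottom.
have [jn|jn] := eqVneq j (i + n%:Z - 1).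
  rewrite /diamond; have [-> -> _ _] := frieze_top _ _ jn.
  rewrite (@frieze_Pt_top i (j + 1)); last by lia.
  exact: CM_top.
apply: (Heronian_CM two_neq0 (proj1 Hz _ _ hij)).
by apply/eqP/z_neq0; lia.
Qed.

Lemma frieze_right i j : 1 <= j - i <= n%:Z - 1 ->
  dM_right (diamond z i j) = - 2 * (z (PtL i j) * z (PtR i j)).
Proof. by move=> hij; exact: Heronian_right (proj1 Hz _ _ hij). Qed.

Lemma frieze_left i j : 1 <= j - i <= n%:Z - 1 ->
  dM_left (diamond z i j) = - 2 * (z (PtL i (j + 1)) * z (PtR (i + 1) j)).
Proof. by move=> hij; exact: Heronian_left (proj1 Hz _ _ hij). Qed.

Lemma frieze_up i j : 2 <= j - i <= n%:Z - 1 ->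
  dM_up (diamond z i j) = 2 * (z (PtL i j) * z (PtR (i + 1) j)).
Proof.
move=> hij; have [jn|jn] := eqVneq j (i + n%:Z - 1).
  rewrite /diamond; have [-> -> -> p2] := frieze_top _ _ jn.
  rewrite (@frieze_Pt_top i (j + 1)); last by lia.
  by rewrite dM_up_top -p2 expr2.
apply: (Heronian_up two_neq0 (proj1 Hz i j _)); first by lia.
by apply/eqP/z_neq0; lia.
Qed.

Lemma frieze_down i j : 1 <= j - i <= n%:Z - 2 ->
  dM_down (diamond z i j) = 2 * (z (PtR i j) * z (PtL i (j + 1))).
Proof.
move=> hij; have [j1|j1] := eqVneq j (i + 1).
  rewrite /diamond; have [-> -> -> q2] := frieze_bottom _ _ j1.
  by rewrite (@frieze_Pt_bottom (i + 1) j) // dM_down_bottom -q2 expr2.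
apply: (Heronian_down two_neq0 (proj1 Hz i j _)); first by lia.
by apply/eqP/z_neq0; lia.
Qed.

Lemma Heronian_frieze_coherent : coherent_CM_frieze n z.
Proof.
split; first split.
- exact: frieze_CM_diamond.
- move=> i.
  (* The node [(i, i + 1)] is the entry [e] of one bottom diamond and [f] of the previous one;
     comparing the two values identifies [Slash i] with [Bslash i]. The node [(i, i + n - 1)] plays
     the same role at the top. *)
  have [eb _ _ _] := frieze_bottom i (i + 1) erefl.
  have [_ fd _ _] := frieze_bottom (i - 1) i ltac:(lia).
  have [ed _ _ _] := frieze_top i (i + n%:Z - 1) erefl.
  have [_ fb _ _] := frieze_top (i - 1) (i + n%:Z - 2) ltac:(lia).
  rewrite subrK in fd, fb.
  rewrite (_ : i + n%:Z - 2 + 1 = i + n%:Z - 1) in fb; last by lia.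
  split; [exact: frieze_Pt_bottom | by rewrite eb -fd eb
    | exact: frieze_Pt_top | by rewrite fb -ed fb].
- move=> i j hij.
  rewrite frieze_left ?frieze_right ?frieze_up ?frieze_down; try lia.
  by rewrite !subrK; ring.
Qed.

End HeronianFrieze.

(** * Induction and recursion over the integers in both directions *)

Lemma int_shift_ind (P : int -> Prop) :
  P 0 -> (forall i, P i <-> P (i + 1)) -> forall i, P i.
Proof.
move=> P0 PS [] m; elim: m => [|m IHm].
- exact: P0.
- by rewrite -addn1 PoszD -PS.
- by apply/PS.
- by apply/PS; rewrite (_ : Negz m.+1 + 1 = Negz m) //; lia.
Qed.

(** The relation is solved outwards from 0, forwards by [u] and backwards by [v]. As [Negz m] is
    [-(m + 1)], its value is [v m.+1]. *)
Lemma int_ratio_rec {K : fieldType} (A : int -> K) (w0 : K) :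
  (forall i, A i != 0) -> w0 != 0 ->
  exists2 w : int -> K, w 0 = w0 & forall i, w i * w (i + 1) = A i.
Proof.
move=> A_neq0 w0_neq0.
pose u := fix u m := if m is m'.+1 then A m'%:Z / u m' else w0.
pose v := fix v m := if m is m'.+1 then A (Negz m') / v m' else w0.
have u_neq0 m : u m != 0.
  by elim: m => //= m IHm; rewrite mulf_neq0 ?invr_neq0.
have v_neq0 m : v m != 0.
  by elim: m => //= m IHm; rewrite mulf_neq0 ?invr_neq0.
exists (fun i => match i with Posz m => u m | Negz m => v m.+1 end) => // -[m|m].
  by rewrite -[m%:Z + 1]/(Posz (m + 1)) addn1 /= mulrCA mulfV ?mulr1.
case: m => [|m]; first by rewrite /= divfK.
by rewrite (_ : Negz m.+1 + 1 = Negz m); [rewrite /= divfK // (v_neq0 m.+1) | lia].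
Qed.

Lemma heronH_rot {K : comNzRingType} (x y t : K) : heronH t y x = heronH x y t.
Proof. by rewrite /heronH; ring. Qed.

(** * Uniqueness of the extension up to a global sign *)

Section Uniqueness.
Context {K : fieldType}.
Hypothesis two_neq0 : 2 != 0 :> K.
Context {n : nat}.
Hypothesis hn : (4 <= n)%N.
Context {z z' : frieze_index -> K}.
Hypothesis Hz : Heronian_frieze n z.
Hypothesis Hz' : Heronian_frieze n z'.
Hypothesis zz' : eq_on (ICM_ n) z' z.
Hypothesis z_neq0 : forall i j : int, 2 <= j - i <= n%:Z - 2 -> z (Pt i j) <> 0.
Hypothesis H_neq0 : forall i j : int, 2 <= j - i <= n%:Z - 1 ->
        heronH (z (Pt i j)) (z (Pt (i + 1) j)) (z (Slash i)) <> 0 /\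
        heronH (z (Pt i (j - 1))) (z (Pt i j)) (z (Bslash (j - 1))) <> 0.

Lemma eq_diamond i j : 1 <= j - i <= n%:Z - 1 -> diamond z' i j = diamond z i j.
Proof.
by move=> hij; rewrite /diamond !zz' //; rewrite unfold_in /=; lia.
Qed.

Lemma z'_neq0 i j : 2 <= j - i <= n%:Z - 2 -> z' (Pt i j) <> 0.
Proof.
by move=> hij; rewrite zz'; [exact: z_neq0 | rewrite unfold_in /=; lia].
Qed.

Lemma PtL_neq0 i j : 2 <= j - i <= n%:Z - 1 -> z (PtL i j) != 0.
Proof.
move=> hij; have [/eqP HH _] := H_neq0 _ _ hij.
have [[p2 _ _ _] _ _ _] := (proj1 Hz) i j ltac:(lia).
by rewrite -sqrf_eq0 p2 heronH_rot.
Qed.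

Lemma PtL_PtR_eq i j : 1 <= j - i <= n%:Z - 1 ->
  z' (PtL i j) * z' (PtR i j) = z (PtL i j) * z (PtR i j).
Proof.
move=> hij; have := frieze_right Hz' _ _ hij.
rewrite eq_diamond // (frieze_right Hz) // => /mulfI -> //.
by rewrite oppr_eq0.
Qed.

Lemma PtL_PtR_succ_eq i j : 2 <= j - i <= n%:Z - 1 ->
  z' (PtL i j) * z' (PtR (i + 1) j) = z (PtL i j) * z (PtR (i + 1) j).
Proof.
move=> hij; have := frieze_up hn Hz' two_neq0 z'_neq0 _ _ hij.
rewrite eq_diamond ?(frieze_up hn Hz two_neq0 z_neq0) //; last by lia.
by move/mulfI => ->.
Qed.

(** A sign is its own inverse, so it passes from one factor of a common nonzero product to the
    other. *)
Lemma sign_cancel (eps p q p' q' : K) : eps ^+ 2 = 1 -> p != 0 ->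
  p' * q' = p * q -> p' = eps * p -> q' = eps * q.
Proof.
move=> e2 p0 pq pp; apply: (mulfI p0).
by rewrite mulrCA -pq pp mulrA mulrA -expr2 e2 mul1r.
Qed.

Lemma Heronian_frieze_sign : exists2 eps : K, eps = 1 \/ eps = -1 &
  forall i j,
    (1 <= j - i <= n%:Z -> z' (PtL i j) = eps * z (PtL i j)) /\
    (0 <= j - i <= n%:Z - 1 -> z' (PtR i j) = eps * z (PtR i j)).
Proof.
(* The sign is read off at the node [(1/2, 2)], where the squares of both friezes agree. *)
have [eps eps1 eps0] : exists2 eps : K, eps = 1 \/ eps = -1 &
    z' (PtL 0 2) = eps * z (PtL 0 2).
  have [[p2 _ _ _] _ _ _] := (proj1 Hz) 0 2 ltac:(lia).
  have [[p2' _ _ _] _ _ _] := (proj1 Hz') 0 2 ltac:(lia).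
  have : z' (PtL 0 2) ^+ 2 = z (PtL 0 2) ^+ 2.
    by rewrite p2 p2' !zz' //; rewrite unfold_in /=; lia.
  move/eqP; rewrite eqf_sqr => /orP[] /eqP ->.
    by exists 1; [left | rewrite mul1r].
  by exists (-1); [right | rewrite mulN1r].
have eps2 : eps ^+ 2 = 1 by case: eps1 => ->; ring.
exists eps => //.
have row2 i : z' (PtL i (i + 2)) = eps * z (PtL i (i + 2)).
  apply: (int_shift_ind (fun i => z' (PtL i (i + 2)) = eps * z (PtL i (i + 2)))).
    exact: eps0.
  (* In the bottom diamond at [(i + 1, i + 2)] the entries [q] and [r] agree. So the product given
     by up at [(i, i + 2)] links two consecutive entries of this row, and the sign travels both
     ways. *)
  move=> {}i; have ps := PtL_PtR_succ_eq i (i + 2) ltac:(lia).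
  have [_ _ rq _] := frieze_bottom hn Hz (i + 1) (i + 2) ltac:(lia).
  have [_ _ rq' _] := frieze_bottom hn Hz' (i + 1) (i + 2) ltac:(lia).
  rewrite -rq -rq' (_ : i + 2 + 1 = i + 1 + 2) in ps; last by lia.
  split; first by apply: sign_cancel eps2 _ ps; apply: PtL_neq0; lia.
  rewrite mulrC [RHS]mulrC in ps.
  by apply: sign_cancel eps2 _ ps; apply: PtL_neq0; lia.
have nextR (i j : int) : 2 <= j - i <= n%:Z - 1 -> z' (PtL i j) = eps * z (PtL i j) ->
    z' (PtR i j) = eps * z (PtR i j) /\
    z' (PtR (i + 1) j) = eps * z (PtR (i + 1) j).
  move=> hij p; have p0 := PtL_neq0 _ _ hij.
  split; apply: (sign_cancel _ _ _ _ _ eps2 p0) p; last exact: PtL_PtR_succ_eq.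
  by apply: PtL_PtR_eq; lia.
have rowL m (i j : int) : j - i = m%:Z + 2 -> j - i <= n%:Z - 1 ->
    z' (PtL i j) = eps * z (PtL i j).
  elim: m i j => [|m IHm] i j jm jn.
    by rewrite (_ : j = i + 2); [exact: row2 | lia].
  have p := IHm i (j - 1) ltac:(lia) ltac:(lia).
  have [q s] := nextR i (j - 1) ltac:(lia) p.
  have [_ rs _ _] := (proj1 Hz) i (j - 1) ltac:(lia).
  have [_ rs' _ _] := (proj1 Hz') i (j - 1) ltac:(lia).
  rewrite subrK in rs, rs'.
  (* The next row is the entry [r], recovered from [r + s = p + q]. *)
  apply: (addIr (z' (PtR (i + 1) (j - 1)))).
  by rewrite rs' s p q -!mulrDr rs.
have {}rowL (i j : int) : 1 <= j - i <= n%:Z -> z' (PtL i j) = eps * z (PtL i j).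
  move=> hij; have [j1|j1] := eqVneq j (i + 1).
    by rewrite (frieze_PtL_bottom hn Hz) // (frieze_PtL_bottom hn Hz') // mulr0.
  have [jn|jn] := eqVneq j (i + n%:Z).
    by rewrite (frieze_PtL_top hn Hz) // (frieze_PtL_top hn Hz') // mulr0.
  by apply: (rowL `|(j - i - 2)%R|%N); lia.
move=> i j; split=> [|hij]; first exact: rowL.
have [j1|j1] := eqVneq j i.
  by rewrite (frieze_PtR_bottom hn Hz) // (frieze_PtR_bottom hn Hz') // mulr0.
have [jn|jn] := eqVneq j (i + n%:Z - 1).
  by rewrite (frieze_PtR_top hn Hz) // (frieze_PtR_top hn Hz') // mulr0.
(* [PtR i j] is the entry [s] of the diamond at [(i - 1, j)], whose [p] is already settled. *)
have [_] := nextR (i - 1) j ltac:(lia) (rowL (i - 1) j ltac:(lia)).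
by rewrite subrK.
Qed.

End Uniqueness.

(** * Invariance under equality on the index set and under a global sign *)

Section Transport.
Context {K : comNzRingType}.
Implicit Types z : frieze_index -> K.

Lemma Heronian_frieze_eq_on n z z' :
  eq_on (I_ n) z' z -> Heronian_frieze n z -> Heronian_frieze n z'.
Proof.
move=> zz' [Hd H0]; split=> [i j hij | v vN v0]; last by rewrite zz' ?H0.
have := Hd i j hij.
by rewrite -!zz' //; rewrite unfold_in /= ?unfold_in /= /dbl_gap /=; lia.
Qed.

(** In [p], [q], [r], [s] jointly, each diamond equation has both sides even or both sides odd. *)
Lemma Heronian_frieze_flip n z :
  Heronian_frieze n z -> Heronian_frieze n (flip_sign n z).
Proof.
move=> [Hd H0]; split=> [i j hij | v vN v0]; last first.
  by rewrite /flip_sign H0 // oppr0 if_same.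
have flipP i' j' : 0 <= j' - i' <= n%:Z -> flip_sign n z (Pt i' j') = z (Pt i' j').
  by rewrite /flip_sign unfold_in /= => ->.
rewrite !flipP; try lia; rewrite /flip_sign /=.
have [[p2 q2 r2 s2] rs ef ers] := Hd i j hij.
split; [by rewrite !sqrrN | by rewrite -!opprD rs | by rewrite -opprD sqrrN |].
by rewrite -opprD mulrN ers; ring.
Qed.

End Transport.

(** * Construction of the Heronian extension row by row *)

Section Construction.
Context {K : fieldType}.
Implicit Types (z : frieze_index -> K) (w : int -> K).

(* [(half_row z w m i).1] and [(half_row z w m i).2] are the values at the nodes
   (i + 1/2, i + m + 2) and (i + 1, i + m + 5/2): the entries p and s of the
   diamond at (i, i + m + 2). *)
Fixpoint half_row z w (m : nat) (i : int) : K * K :=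
  if m is k.+1 then
    let q j := - dM_right (diamond z j (j + k%:Z + 2)) / (2 * (half_row z w k j).1) in
    ((half_row z w k i).1 + q i - (half_row z w k i).2, q (i + 1))
  else (w i, w (i + 1)).

(** The default 0 provides the boundary zeros. [PtR i j] is the entry [s] of the diamond at
    [(i - 1, j)], which explains the start [i - 1] and the row number [j - i - 1]. *)
Definition extension (n : nat) z w : frieze_index -> K := fun x =>
  match x with
  | Node (PtL i j) =>
      if 2 <= j - i <= n%:Z - 1 then (half_row z w `|(j - i - 2)%R|%N i).1 else 0
  | Node (PtR i j) =>
      if 1 <= j - i <= n%:Z - 2 then (half_row z w `|(j - i - 1)%R|%N (i - 1)).2 else 0
  | _ => z x
  end.

Hypothesis two_neq0 : 2 != 0 :> K.
Context {n : nat}.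
Hypothesis hn : (4 <= n)%N.
Context {z : frieze_index -> K}.
Hypothesis zCM : coherent_CM_frieze n z.
Hypothesis z_neq0 : forall i j : int, 2 <= j - i <= n%:Z - 2 -> z (Pt i j) <> 0.
Hypothesis H_neq0 : forall i j : int, 2 <= j - i <= n%:Z - 1 ->
        heronH (z (Pt i j)) (z (Pt (i + 1) j)) (z (Slash i)) <> 0 /\
        heronH (z (Pt i (j - 1))) (z (Pt i j)) (z (Bslash (j - 1))) <> 0.

Lemma CM_bottom_row (i j : int) : j = i + 1 ->
  [/\ z (Pt (i + 1) j) = 0, z (Pt i j) = z (Slash i)
    & z (Pt (i + 1) (j + 1)) = z (Bslash j)].
Proof.
move=> ->; have [_ hb] := proj1 zCM.
have [_ [e1 e2] _ _] := hb i; have [c0 [f1 f2] _ _] := hb (i + 1).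
by rewrite c0 e1 f1 f2.
Qed.

Lemma CM_top_row (i j : int) : j = i + n%:Z - 1 ->
  [/\ z (Pt i (j + 1)) = 0, z (Pt i j) = z (Bslash j)
    & z (Pt (i + 1) (j + 1)) = z (Slash i)].
Proof.
move=> ->; have [_ hb] := proj1 zCM.
have [_ _ a0 [e1 e2]] := hb i; have [_ _ _ [f1 f2]] := hb (i + 1).
rewrite subrK a0 e1 e2 (_ : i + n%:Z = i + 1 + n%:Z - 1); last by lia.
by rewrite f1 addrK.
Qed.

(* The squares that the entries p and s of a diamond must have. *)
Let Hp (i j : int) := heronH (z (Slash i)) (z (Pt (i + 1) j)) (z (Pt i j)).
Let Hs (i j : int) :=
  heronH (z (Pt (i + 1) j)) (z (Pt (i + 1) (j + 1))) (z (Bslash j)).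

Lemma Hp_neq0 i j : 2 <= j - i <= n%:Z - 1 -> Hp i j != 0.
Proof. by move=> /H_neq0 [/eqP + _]; rewrite /Hp heronH_rot. Qed.

Lemma Hs_neq0 i j : 2 <= j - i <= n%:Z - 1 -> Hs i j != 0.
Proof.
move=> hij; have [_ /eqP] := H_neq0 (i + 1) (j + 1) ltac:(lia).
by rewrite addrK.
Qed.

Lemma dM_up_diamond_sqr i j : 1 <= j - i <= n%:Z - 1 ->
  dM_up (diamond z i j) ^+ 2 = 4 * Hp i j * Hs i j.
Proof. by move=> hij; apply/dM_up_sqr/(proj1 (proj1 zCM)). Qed.

(** Both sides prescribe the square of an entry of the bottom diamond at [(i + 1, i + 2)], where
    [q = r]. This is why [w (i + 1)] can serve as the [s] belonging to [w i]. *)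
Lemma Hs_bottom i : Hs i (i + 2) = Hp (i + 1) (i + 1 + 2).
Proof.
have [c0 eb fd] := CM_bottom_row (i + 1) (i + 2) ltac:(lia).
rewrite /Hs /Hp eb -fd (_ : i + 2 + 1 = i + 1 + 2); last by lia.
by rewrite /heronH; ring.
Qed.

Section Rows.
Context {w : int -> K}.
Hypothesis w_sqr : forall i, w i ^+ 2 = Hp i (i + 2).
Hypothesis w_up : forall i, dM_up (diamond z i (i + 2)) = 2 * (w i * w (i + 1)).

Notation row := (half_row z w).

Lemma half_row_Heronian (m : nat) (i j : int) : j = i + m%:Z + 2 -> j - i <= n%:Z - 2 ->
  (row m i).1 ^+ 2 = Hp i j -> (row m i).2 ^+ 2 = Hs i j ->
  dM_up (diamond z i j) = 2 * ((row m i).1 * (row m i).2) ->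
  Heronian_diamond
    (z (Pt i (j + 1))) (z (Slash i)) (z (Pt (i + 1) j)) (z (Bslash j))
    (z (Pt i j)) (z (Pt (i + 1) (j + 1)))
    (row m i).1 (row m.+1 (i - 1)).2 (row m.+1 i).1 (row m i).2.
Proof.
move=> jm hij p2 s2 ps.
have M : CM_diamond (diamond z i j) by apply: (proj1 (proj1 zCM)); lia.
have p0 : (row m i).1 != 0 by rewrite -sqrf_eq0 p2 Hp_neq0 //; lia.
have e0 : z (Pt i j) != 0 by apply/eqP/z_neq0; lia.
have := Heronian_of_CM two_neq0 M p0 e0 p2 s2 ps.
by rewrite /= subrK -jm.
Qed.

(** The first three claims are what [half_row_Heronian] needs to build the next row. The fourth is
    carried along because coherence has down as a factor, which must be known and nonzero to be
    cancelled. *)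
Lemma half_row_invariant (m : nat) (i j : int) : j = i + m%:Z + 2 -> j - i <= n%:Z - 1 ->
  [/\ (row m i).1 ^+ 2 = Hp i j, (row m i).2 ^+ 2 = Hs i j,
      dM_up (diamond z i j) = 2 * ((row m i).1 * (row m i).2)
    & dM_down (diamond z (i + 1) j) = 2 * ((row m i).2 * (row m (i + 1)).1)].
Proof.
elim: m i j => [|m IHm] i j jm hij.
  have -> : j = i + 2 by lia.
  split; rewrite /= ?w_sqr ?w_up ?Hs_bottom //.
  have [c0 eb fd] := CM_bottom_row (i + 1) (i + 2) ltac:(lia).
  rewrite -expr2 w_sqr -Hs_bottom /diamond c0 eb fd dM_down_bottom.
  by rewrite /Hs eb /heronH; ring.
have [p2 s2 ps _] := IHm i (j - 1) ltac:(lia) ltac:(lia).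
have [p2' s2' ps' dn'] := IHm (i + 1) j ltac:(lia) ltac:(lia).
have [_ _ _ dn] := IHm i (j - 1) ltac:(lia) ltac:(lia).
have L := half_row_Heronian m i (j - 1) ltac:(lia) ltac:(lia) p2 s2 ps.
have R := half_row_Heronian m (i + 1) j ltac:(lia) ltac:(lia) p2' s2' ps'.
have r2 : (row m.+1 i).1 ^+ 2 = Hp i j.
  by have [[_ _ + _] _ _ _] := L; rewrite subrK => ->; rewrite /Hp /heronH; ring.
have q2 : (row m.+1 i).2 ^+ 2 = Hs i j.
  by have [[_ + _ _] _ _ _] := R; rewrite addrK => ->; rewrite /Hs /heronH; ring.
split=> //.
  (* Coherence at [(i + 1, j)] reads [4 r s p q = up * (2 s p)], with [r], [s] from [L] and [p], [q]
     from [R]. Cancelling [2 s p] leaves [up = 2 r q], the product relation on the new row. *)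
  have := proj2 zCM (i + 1) j ltac:(lia); rewrite addrK dn.
  rewrite (Heronian_left L) (Heronian_right R) addrK => coh.
  have p0 : (row m (i + 1)).1 != 0 by rewrite -sqrf_eq0 p2' Hp_neq0 //; lia.
  have s0 : (row m i).2 != 0 by rewrite -sqrf_eq0 s2 Hs_neq0 //; lia.
  apply: (mulIf (mulf_neq0 two_neq0 (mulf_neq0 s0 p0))).
  by rewrite -coh; ring.
have e0 : z (Pt (i + 1) j) != 0 by apply/eqP/z_neq0; lia.
by rewrite (Heronian_down two_neq0 R e0) addrK.
Qed.

Lemma ext_PtL m i j : j = i + m%:Z + 2 -> j - i <= n%:Z - 1 ->
  extension n z w (PtL i j) = (row m i).1.
Proof.
move=> jm hij; rewrite /extension ifT; last by lia.
by rewrite (_ : absz _ = m) //; lia.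
Qed.

Lemma ext_PtR m i j : j = i + m%:Z + 1 -> j - i <= n%:Z - 2 ->
  extension n z w (PtR i j) = (row m (i - 1)).2.
Proof.
move=> jm hij; rewrite /extension ifT; last by lia.
by rewrite (_ : absz _ = m) //; lia.
Qed.

Lemma ext_PtL0 i j : (j - i <= 1) || (n%:Z <= j - i) ->
  extension n z w (PtL i j) = 0.
Proof. by move=> hij; rewrite /extension ifF //; lia. Qed.

Lemma ext_PtR0 i j : (j - i <= 0) || (n%:Z - 1 <= j - i) ->
  extension n z w (PtR i j) = 0.
Proof. by move=> hij; rewrite /extension ifF //; lia. Qed.

Lemma extension_Heronian : Heronian_frieze n (extension n z w).
Proof.
split=> [i j hij|]; last first.
  case=> i j; rewrite !inE /dbl_gap /= => hN h0.
  - have [j0|jn] : j = i \/ j = i + n%:Z by lia.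
      by rewrite j0; have [_ /(_ i)[]] := proj1 zCM.
    by rewrite jn; have [_ /(_ i)[]] := proj1 zCM.
  - by apply: ext_PtL0; lia.
  - by apply: ext_PtR0; lia.
have [j1|j1] := eqVneq j (i + 1).
  have [c0 eb fd] := CM_bottom_row i j j1.
  rewrite (ext_PtL0 i j) ?(ext_PtR0 (i + 1) j); try lia.
  rewrite (ext_PtL 0 i (j + 1)) ?(ext_PtR 0 i j); try lia.
  rewrite /= c0 eb fd subrK; apply: bottom_Heronian.
  rewrite w_sqr /Hp (_ : i + 2 = j + 1); last by lia.
  by rewrite fd /heronH; ring.
have [jn|jn] := eqVneq j (i + n%:Z - 1).
  have [a0 ed fb] := CM_top_row i j jn.
  have [m jm] : exists m : nat, j = i + m%:Z + 2 by exists (n - 3)%N; lia.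
  have [p2 s2 ps _] := half_row_invariant m i j jm ltac:(lia).
  rewrite (ext_PtL0 i (j + 1)) ?(ext_PtR0 i j); try lia.
  rewrite (ext_PtL m i j) ?(ext_PtR m (i + 1) j); try lia.
  have {}p2 : (row m i).1 ^+ 2 = heronH (z (Slash i)) (z (Pt (i + 1) j)) (z (Bslash j)).
    by rewrite p2 /Hp ed.
  have p0 : (row m i).1 != 0 by rewrite -sqrf_eq0 p2 -ed Hp_neq0 //; lia.
  (* On the top row up equals both [2ps] and [2 p^2], so [s = p], as the degenerate diamond
     requires. *)
  have <- : (row m i).1 = (row m (i + 1 - 1)).2.
    apply: (mulfI p0); apply: (mulfI two_neq0).
    by rewrite addrK -ps /diamond a0 ed fb dM_up_top -p2 expr2.
  by rewrite /= a0 ed fb; apply: top_Heronian.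
have [m jm] : exists m : nat, j = i + m%:Z + 2 by exists (absz (j - i - 2)%R); lia.
have [p2 s2 ps _] := half_row_invariant m i j jm ltac:(lia).
have := half_row_Heronian m i j jm ltac:(lia) p2 s2 ps.
rewrite (ext_PtL m i j) ?(ext_PtR m (i + 1) j); try lia.
rewrite (ext_PtL m.+1 i (j + 1)) ?(ext_PtR m.+1 i j); try lia.
by rewrite addrK.
Qed.

End Rows.

Lemma Heronian_extension_exists (w0 : K) : w0 ^+ 2 = Hp 0 2 ->
  exists2 w, Heronian_frieze n (extension n z w) & eq_on (ICM_ n) (extension n z w) z.
Proof.
move=> w02.
have w0_neq0 : w0 != 0 by rewrite -sqrf_eq0 w02 Hp_neq0 //; lia.
have four : 4 != 0 :> K by rewrite (_ : 4 = 2 * 2) ?mulf_neq0 //; ring.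
have HpHp i : dM_up (diamond z i (i + 2)) ^+ 2 =
    4 * Hp i (i + 2) * Hp (i + 1) (i + 1 + 2).
  by rewrite dM_up_diamond_sqr ?Hs_bottom //; lia.
have A_neq0 i : dM_up (diamond z i (i + 2)) / 2 != 0.
  rewrite mulf_neq0 ?invr_neq0 // -sqrf_eq0 HpHp.
  by rewrite !mulf_neq0 // Hp_neq0 //; lia.
have [w w0E wA] := int_ratio_rec _ w0 A_neq0 w0_neq0.
have w_up i : dM_up (diamond z i (i + 2)) = 2 * (w i * w (i + 1)).
  by rewrite wA mulrC divfK.
exists w; last by case=> [[]||].
apply: (extension_Heronian _ w_up).
(* By the discriminant identity the products of consecutive squares are right, so the square
   condition at [i] is equivalent to the one at [i + 1]; it holds at 0 by the choice of [w0]. *)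
apply: int_shift_ind => [|i]; first by rewrite w0E.
have ww : w i ^+ 2 * w (i + 1) ^+ 2 = Hp i (i + 2) * Hp (i + 1) (i + 1 + 2).
  by apply: (mulfI four); rewrite [RHS]mulrA -HpHp w_up; ring.
have h1 : Hp i (i + 2) != 0 by rewrite Hp_neq0 //; lia.
have h2 : Hp (i + 1) (i + 1 + 2) != 0 by rewrite Hp_neq0 //; lia.
split=> [wi|wi]; rewrite wi in ww; first exact: mulfI ww.
exact: mulIf ww.
Qed.

End Construction.

(** * Existence and uniqueness combined over the complex numbers *)

Lemma ICM_subset n : {subset ICM_ n <= I_ n}.
Proof.
by case=> [[] i j|i|i]; rewrite !unfold_in //= ?unfold_in /dbl_gap /=; lia.
Qed.

Theorem theorem6p5 (R : realType) (n : nat) (hn : (4 <= n)%N) :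
  (forall z : frieze_index -> R[i],
     Heronian_frieze n z ->
     (forall i j : int, 2 <= j - i <= n%:Z - 2 -> z (Pt i j) <> 0) ->
     coherent_CM_frieze n z)
  /\
  (forall zCM : frieze_index -> R[i],
     coherent_CM_frieze n zCM ->
     (forall i j : int, 2 <= j - i <= n%:Z - 2 -> zCM (Pt i j) <> 0) ->
     (forall i j : int, 2 <= j - i <= n%:Z - 1 ->
        heronH (zCM (Pt i j)) (zCM (Pt (i + 1) j)) (zCM (Slash i)) <> 0 /\
        heronH (zCM (Pt i (j - 1))) (zCM (Pt i j)) (zCM (Bslash (j - 1))) <> 0) ->
     exists z : frieze_index -> R[i],
       (Heronian_frieze n z /\ eq_on (ICM_ n) z zCM) /\
       (forall z' : frieze_index -> R[i],
          Heronian_frieze n z' /\ eq_on (ICM_ n) z' zCM <->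
          eq_on (I_ n) z' z \/ eq_on (I_ n) z' (flip_sign n z))).

Proof.
have two_neq0 : 2 != 0 :> R[i] by rewrite pnatr_eq0.
split=> [z Hz z_neq0|zCM coh z_neq0 H_neq0].
  exact: Heronian_frieze_coherent.
(* [sqrtCK] supplies the single square root from which the extension starts; the earlier sections
   work over any field in which 2 is nonzero. *)
have [w Hz zz] := Heronian_extension_exists two_neq0 hn coh z_neq0 H_neq0 _
  (sqrtCK _).
exists (extension n zCM w); split=> // z'.
split=> [[Hz' z'z]|]; last first.
  case=> z'z; split; try exact: Heronian_frieze_eq_on z'z _.
  - move=> x xCM; rewrite z'z ?zz //.
    exact: ICM_subset.
  - by apply: Heronian_frieze_eq_on z'z _; apply: Heronian_frieze_flip.
  - move=> x xCM; rewrite z'z ?/flip_sign ?xCM ?zz //.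
    exact: ICM_subset.
have z'ext : eq_on (ICM_ n) z' (extension n zCM w) by move=> x xCM; rewrite z'z ?zz.
have [eps eps1 epsP] :=
  Heronian_frieze_sign two_neq0 hn Hz Hz' z'ext z_neq0 H_neq0.
(* The indices added to [ICM_ n] are half-integer nodes, where the common sign [eps] applies. *)
have zP x : x \in I_ n -> x \notin ICM_ n -> z' x = eps * extension n zCM w x.
  case: x => [[] i j|i|i] //; rewrite !unfold_in /= ?unfold_in /dbl_gap /= => hN hCM.
  - by lia.
  - by have [-> //] := epsP i j; lia.
  - by have [_ -> //] := epsP i j; lia.
case: eps1 => e1; [left|right] => x xI; rewrite ?/flip_sign.
  by have [/z'ext //|/zP ->] := boolP (x \in ICM_ n); rewrite ?e1 ?mul1r.
by have [/z'ext //|/zP ->] := boolP (x \in ICM_ n); rewrite ?e1 ?mulN1r.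
Qed.
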